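(* Let $\mathcal{X}$ and $\mathcal{Y}$ be labeled metric spaces, with labels of potentially different sizes (i.e. $\mathcal{X}$ is $k$-labeled and $\mathcal{Y}$ is $\ell$-labeled for some positive integers $k,\ell$), and let $j$ be a nonnegative integer. Then $$\mathsf{Int}_{st}(\mathrm{LPH}_j(\mathcal{X}),\mathrm{LPH}_j(\mathcal{Y}))\le 2\cdot\mathsf{GH}_{st}(\mathcal{X},\mathcal{Y}).$$
   Context: For a positive integer $k$, $[k]:=\{1,\ldots,k\}$. A $k$-labeled metric space is a triple $\mathcal{X}=(X,d_X,L_X)$, where $(X,d_X)$ is a compact metric space and $L_X=(X_1,\ldots,X_k)$ is a finite sequence of nonempty subsets $X_i\subset X$ with $X=\bigcup_{i=1}^k X_i$ (the $X_i$ may overlap). For sets $A,B$, $\mathcal{C}(A,B)$ denotes the set of correspondences, i.e. subsets $C\subset A\times B$ whose coordinate projections to $A$ and to $B$ are both surjective. For $C\in\mathcal{C}(X_i,Y_i)$, $C'\in\mathcal{C}(X_j,Y_j)$, let $\mathrm{dis}(C,C'):=\sup_{(x,y)\in C,\ (x',y')\in C'}|d_X(x,x')-d_Y(y,y')|$. For $q$-labeled metric spaces, $$\mathsf{GH}_q(\mathcal{X},\mathcal{Y}):=\frac12\inf_{(C_1,\ldots,C_q)}\ \max_{i,j=1,\ldots,q}\mathrm{dis}(C_i,C_j),\qquad C_i\in\mathcal{C}(X_i,Y_i).$$ For a $k$-labeled metric space $\mathcal{X}$ and $q\ge k$, a $q$-stabilization of $\mathcal{X}$ is a $q$-labeled metric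 space $\widehat{\mathcal{X}}=(X,d_X,(\widehat{X}_1,\ldots,\widehat{X}_q))$ such that there is a surjective map $\rho:[q]\to[k]$ with $\widehat{X}_i=X_{\rho(i)}$ for all $i\in[q]$. Define $\mathsf{GH}_{st}(\mathcal{X},\mathcal{Y}):=\inf_{\widehat{\mathcal{X}},\widehat{\mathcal{Y}}}\mathsf{GH}_q(\widehat{\mathcal{X}},\widehat{\mathcal{Y}})$, over all $q$ and all $q$-stabilizations $\widehat{\mathcal{X}}$ of $\mathcal{X}$ and $\widehat{\mathcal{Y}}$ of $\mathcal{Y}$. Fix a field $\mathbb{F}$. For a poset $Q$, a $Q$-module is a functor $V:Q\to\mathrm{Vect}_{\mathbb{F}}$ from the poset category $Q$ to $\mathbb{F}$-vector spaces; morphisms are natural transformations. For a poset $(P,\preccurlyeq)$, $\mathbb{R}\times P$ has the product order. For an $(\mathbb{R}\times P)$-module $V$ and $\epsilon\ge0$, the shift $V_\epsilon$ is $V_\epsilon(r,p):=V(r+\epsilon,p)$. Modules $V,V'$ over $\mathbb{R}\times P$ are $\epsilon$-interleaved if there are morphisms $\phi:V\to V'_\epsilon$ and $\psi:V'\to V_\epsilon$ such that $\psi_{r+\epsilon,p}\circ\phi_{r,p}=V((r,p)\preccurlyeq(r+2\epsilon,p))$ and $\phi_{r+\epsilon,p}\circ\psi_{r,p}=V'((r,p)\preccurlyeq(r+2\epsilon,p))$ for all $(r,p)$. $P_k$ is the power set of $[k]$ ordered by inclusion. A surjection $\rho:[q]\to[k]$ induces a poset morphism $\widetilde\rho:P_q\to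 P_k$, $\widetilde\rho(\{p_1,\ldots,p_m\})=\{\rho(p_1),\ldots,\rho(p_m)\}$. For an $(\mathbb{R}\times P_k)$-module $V$, a $q$-stabilization of $V$ is an $(\mathbb{R}\times P_q)$-module of the form $V\circ\widetilde\rho$, $(V\circ\widetilde\rho)(r,p):=V(r,\widetilde\rho(p))$, for some surjective $\rho:[q]\to[k]$. For an $(\mathbb{R}\times P_k)$-module $V$ and an $(\mathbb{R}\times P_\ell)$-module $V'$, say $V,V'$ are stably $\epsilon$-interleaved if for some $q$ there exist $q$-stabilizations of $V$ and $V'$ that are $\epsilon$-interleaved, and set $\mathsf{Int}_{st}(V,V'):=\inf\{\epsilon\ge0 : V,V'\text{ are stably }\epsilon\text{-interleaved}\}$ ($\inf\emptyset:=+\infty$). For a metric space $S$, the Vietoris-Rips complex $\mathrm{VR}_r(S)$ is the simplicial complex whose simplices are the nonempty finite subsets $\sigma\subset S$ with $\mathrm{diam}(\sigma)\le r$ (empty if $r<0$ or $S=\emptyset$). For a $k$-labeled metric space $\mathcal{X}$, the labeled persistent homology $\mathrm{LPH}_j(\mathcal{X})$ is the $(\mathbb{R}\times P_k)$-module $\mathrm{LPH}_j(\mathcal{X})(r,p):=\mathrm{H}_j(\mathrm{VR}_r(\bigcup_{i\in p}X_i))$ (degree-$j$ simplicial homology with coefficients in $\mathbb{F}$), with structure maps induced by inclusions. *)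

(* Defs.v *)
From HB Require Import structures.
From mathcomp Require Import all_boot all_order all_algebra perm.
From mathcomp Require Import finmap.
From mathcomp Require Import all_classical all_reals all_analysis.

Set Implicit Arguments.
Unset Strict Implicit.
Unset Printing Implicit Defensive.

Import Order.TTheory GRing.Theory Num.Theory.
(* [{set T}] is ordered by inclusion. *)
Import Order.DefaultSetSubsetOrder.

Local Open Scope classical_set_scope.
Local Open Scope ring_scope.

(** * Labeled metric spaces and their stable Gromov-Hausdorff distance *)

Record labeledMetricSpace (R : realType) (k : nat) := LabeledMetricSpace {
  lms_carrier :> metricType R;
  lms_compact : compact [set: lms_carrier];
  lms_label : 'I_k -> set lms_carrier;
  lms_label_neq0 : forall i, lms_label i !=set0;
  lms_label_cover : \bigcup_(i in [set: 'I_k]) lms_label i = [set: lms_carrier]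
}.

Arguments lms_compact {R k} _.
Arguments lms_label {R k} _ _.
Arguments lms_label_neq0 {R k} _ _.
Arguments lms_label_cover {R k} _.

Definition correspondence (S T : Type) (A : set S) (B : set T) :
    set (set (S * T)) :=
  [set C | [/\ C `<=` A `*` B, fst @` C = A & snd @` C = B]].

Definition distortion (R : realType) (X Y : metricType R)
    (C C' : set (X * Y)) : \bar R :=
  ereal_sup [set `|mdist z.1 z'.1 - mdist z.2 z'.2|%:E | z in C & z' in C'].

Definition GH (R : realType) (q : nat) (X Y : labeledMetricSpace R q) : \bar R :=
  ((2^-1)%:E *
   ereal_inf [set \big[maxe/-oo]_(i < q) \big[maxe/-oo]_(j < q)
                    distortion (C i) (C j)
             | C in [set C : 'I_q -> set (X * Y) |
                     forall i, correspondence (lms_label X i) (lms_label Y i)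
                                 (C i)]])%E.

Section stabilization.
Context {R : realType} {k q : nat}.
Variables (X : labeledMetricSpace R k) (rho : 'I_q -> 'I_k).
Hypothesis rho_surj : set_surj setT setT rho.

Lemma stab_label_cover :
  \bigcup_(i in [set: 'I_q]) lms_label X (rho i) = [set: X].
Proof.
rewrite -(lms_label_cover X); apply/seteqP; split=> [x [i _ Xx]|x [i _ Xx]].
  by exists (rho i).
by have [j _ ji] := rho_surj (I : [set: 'I_k] i); exists j; rewrite ?ji.
Qed.

Definition lms_stab : labeledMetricSpace R q :=
  {| lms_carrier := X;
     lms_compact := lms_compact X;
     lms_label := fun i => lms_label X (rho i);
     lms_label_neq0 := fun i => lms_label_neq0 X (rho i);
     lms_label_cover := stab_label_cover |}.

End stabilization.

Definition is_lms_stab (R : realType) (k q : nat) (X : labeledMetricSpace R k)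
    (X' : labeledMetricSpace R q) : Prop :=
  exists (rho : 'I_q -> 'I_k) (rho_surj : set_surj setT setT rho),
    X' = lms_stab X rho_surj.

Definition GH_st (R : realType) (k l : nat)
    (X : labeledMetricSpace R k) (Y : labeledMetricSpace R l) : \bar R :=
  ereal_inf [set d | exists (q : nat) (X' Y' : labeledMetricSpace R q),
                       [/\ is_lms_stab X X', is_lms_stab Y Y' & d = GH X' Y']].

(** * Persistence modules over posets and stable interleavings *)

Record pmodule (F : fieldType) d (Q : porderType d) := PModule {
  pm_obj :> Q -> lmodType F;
  pm_map : forall x y : Q, (x <= y)%O -> {linear pm_obj x -> pm_obj y};
  pm_map_id : forall (x : Q) (xx : (x <= x)%O) v, pm_map xx v = v;
  pm_map_comp : forall (x y z : Q) (xy : (x <= y)%O) (yz : (y <= z)%O)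
    (xz : (x <= z)%O) v, pm_map yz (pm_map xy v) = pm_map xz v
}.

Record pmorphism (F : fieldType) d (Q : porderType d) (V W : pmodule F Q) :=
  PMorphism {
  pmor :> forall x : Q, {linear V x -> W x};
  pmor_natural : forall (x y : Q) (xy : (x <= y)%O) v,
    pmor y (pm_map V xy v) = pm_map W xy (pmor x v)
}.

Section pullback.
Context {F : fieldType} {d d' : Order.disp_t}.
Context {Q : porderType d} {Q' : porderType d'}.
Variables (V : pmodule F Q') (g : Q -> Q').
Hypothesis g_homo : {homo g : x y / (x <= y)%O}.

Definition pm_pullback : pmodule F Q :=
  {| pm_obj := fun x => V (g x);
     pm_map := fun x y xy => pm_map V (g_homo xy);
     pm_map_id := fun x xx v => pm_map_id (g_homo xx) v;
     pm_map_comp := fun x y z xy yz xz v =>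
       pm_map_comp (g_homo xy) (g_homo yz) (g_homo xz) v |}.

End pullback.

Section interleaving.
Context {R : realType} {F : fieldType} {d : Order.disp_t} {P : porderType d}.
Implicit Types (V : pmodule F (R *p P)) (e : R).

Definition shiftP e (x : R *p P) : R *p P := (x.1 + e, x.2).

Lemma shiftP_homo e : {homo shiftP e : x y / (x <= y)%O}.
Proof. by move=> x y; rewrite !leEprod /= lerD2r. Qed.

Definition pm_shift e V : pmodule F (R *p P) := pm_pullback V (@shiftP_homo e).

(* [r + e + e] stands for [r + 2 e]: this makes the composite of two shifted
   morphisms and the structure map have the same codomain without a cast. *)
Lemma le_shiftP2 (e : {nonneg R}) x :
  (x <= shiftP e%:num (shiftP e%:num x))%O.
Proof. by rewrite leEprod /= lexx andbT -addrA lerDl addr_ge0. Qed.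

Definition interleaved (e : {nonneg R}) V V' : Prop :=
  exists (phi : pmorphism V (pm_shift e%:num V'))
         (psi : pmorphism V' (pm_shift e%:num V)),
    (forall x v, psi (shiftP e%:num x) (phi x v) = pm_map V (le_shiftP2 e x) v)
    /\
    (forall x v, phi (shiftP e%:num x) (psi x v) = pm_map V' (le_shiftP2 e x) v).

End interleaving.

Section stable_interleaving.
Context {R : realType} {F : fieldType}.

Definition rho_tilde (k q : nat) (rho : 'I_q -> 'I_k)
    (x : R *p {set 'I_q}) : R *p {set 'I_k} :=
  (x.1, [set rho i | i in x.2]%SET).

Lemma rho_tilde_homo (k q : nat) (rho : 'I_q -> 'I_k) :
  {homo rho_tilde rho : x y / (x <= y)%O}.
Proof.
by move=> x y; rewrite !leEprod /= => /andP[-> xy]; exact: imsetS.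
Qed.

Definition pm_stab (k q : nat) (V : pmodule F (R *p {set 'I_k}))
    (rho : 'I_q -> 'I_k) : pmodule F (R *p {set 'I_q}) :=
  pm_pullback V (@rho_tilde_homo k q rho).

Definition is_pm_stab (k q : nat) (V : pmodule F (R *p {set 'I_k}))
    (V' : pmodule F (R *p {set 'I_q})) : Prop :=
  exists2 rho : 'I_q -> 'I_k, set_surj setT setT rho & V' = pm_stab V rho.

Definition stably_interleaved (k l : nat) (e : {nonneg R})
    (V : pmodule F (R *p {set 'I_k}))
    (W : pmodule F (R *p {set 'I_l})) : Prop :=
  exists (q : nat) (V' W' : pmodule F (R *p {set 'I_q})),
    [/\ is_pm_stab V V', is_pm_stab W W' & interleaved e V' W'].

Definition Int_st (k l : nat) (V : pmodule F (R *p {set 'I_k}))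
    (W : pmodule F (R *p {set 'I_l})) : \bar R :=
  ereal_inf [set e%:num%:E | e in [set e : {nonneg R} |
                                   stably_interleaved e V W]].

End stable_interleaving.

(** * Subquotients of vector spaces *)

Section subspace.
Context {F : fieldType} {W : lmodType F}.
Variable Z : submodClosed W.

(* [submodClosed] does not provide the closure under opposites that is needed
   to get a [zmodType]; over a ring it follows from the closure under scaling. *)
Definition subspace_pred : {pred W} := Z.

Lemma subspace_pred_closed : GRing.subsemimod_closed subspace_pred.
Proof.
split; last by move=> a x; exact: rpredZ.
by split; [exact: rpred0 | exact: rpredD].
Qed.

HB.instance Definition _ :=
  GRing.isSubmodClosed.Build F W subspace_pred subspace_pred_closed.

Record subspace := Subspace {
  subspace_val : W;
  subspace_valP : subspace_val \in subspace_pred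
}.

HB.instance Definition _ := [isSub for subspace_val].
HB.instance Definition _ := [Choice of subspace by <:].
HB.instance Definition _ := [SubChoice_isSubZmodule of subspace by <:].
HB.instance Definition _ := [SubZmodule_isSubLmodule of subspace by <:].

End subspace.

Section subquotient.
Context {F : fieldType} {W : lmodType F}.
Variables Z B : submodClosed W.

Definition subspace_in : {pred subspace Z} := [pred z | \val z \in B].

Lemma subspace_in_closed : GRing.subsemimod_closed subspace_in.
Proof.
split=> [|a x]; last by rewrite !inE linearZ; exact: rpredZ.
by split=> [|x y]; rewrite !inE ?linear0 ?rpred0// linearD; exact: rpredD.
Qed.

HB.instance Definition _ :=
  GRing.isSubmodClosed.Build F (subspace Z) subspace_in subspace_in_closed.

(* The quotient of [Z] by [Z `&` B], i.e., [Z / B] when [B] is contained in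
   [Z]. *)
Definition subquotient : Type := Quotient.quot subspace_in.

HB.instance Definition _ := GRing.Zmodule.on subquotient.

Definition subquotient_pi (z : subspace Z) : subquotient :=
  \pi_(Quotient.quot subspace_in)%qT z.

Lemma subquotient_eq (x y : subspace Z) :
  subquotient_pi x = subquotient_pi y <->
  \val x - \val y \in B.
Proof.
have -> : (\val x - \val y \in B) = (x - y \in subspace_in).
  by rewrite inE linearB.
by rewrite Quotient.idealrBE; split=> /eqP.
Qed.

Lemma subquotient_piK (x : subquotient) : subquotient_pi (repr x) = x.
Proof. exact: reprK. Qed.

Lemma subquotient_piD : {morph subquotient_pi : x y / x + y}.
Proof. by move=> x y; rewrite /subquotient_pi !piE. Qed.

Definition subquotient_scale (a : F) (x : subquotient) : subquotient :=
  subquotient_pi (a *: repr x).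

Lemma subquotient_piZ a z :
  subquotient_pi (a *: z) = subquotient_scale a (subquotient_pi z).
Proof.
apply/subquotient_eq; rewrite !linearZ -scalerDr; apply: rpredZ.
by apply/subquotient_eq; rewrite subquotient_piK.
Qed.

Lemma subquotient_scaleA a b x :
  subquotient_scale a (subquotient_scale b x) = subquotient_scale (a * b) x.
Proof. by rewrite -(subquotient_piK x) -!subquotient_piZ scalerA. Qed.

Lemma subquotient_scale1 : left_id 1 subquotient_scale.
Proof. by move=> x; rewrite -(subquotient_piK x) -subquotient_piZ scale1r. Qed.

Lemma subquotient_scaleDr : right_distributive subquotient_scale +%R.
Proof.
move=> a x y; rewrite -(subquotient_piK x) -(subquotient_piK y).
by rewrite -!(subquotient_piD, subquotient_piZ) scalerDr.
Qed.

Lemma subquotient_scaleDl x : {morph subquotient_scale^~ x : a b / a + b}.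
Proof.
move=> a b; rewrite -(subquotient_piK x) -!subquotient_piZ.
by rewrite scalerDl subquotient_piD.
Qed.

HB.instance Definition _ := GRing.Zmodule_isLmodule.Build F subquotient
  subquotient_scaleA subquotient_scale1 subquotient_scaleDr subquotient_scaleDl.

Lemma subquotient_pi_linear : linear subquotient_pi.
Proof. by move=> a x y; rewrite subquotient_piD subquotient_piZ. Qed.

End subquotient.

Section subquotient_map.
Context {F : fieldType} {W : lmodType F} {Z B Z' B' : submodClosed W}.
Hypotheses (ZZ' : {subset Z <= Z'}) (BB' : {subset B <= B'}).

Definition subquotient_map_fun (x : subquotient Z B) : subquotient Z' B' :=
  subquotient_pi B' (Subspace (ZZ' (subspace_valP (repr x)))).

Lemma subquotient_map_pi (z : subspace Z) :
  subquotient_map_fun (subquotient_pi B z) =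
  subquotient_pi B' (Subspace (ZZ' (subspace_valP z))).
Proof.
apply/subquotient_eq => /=; apply: BB'.
exact/subquotient_eq/subquotient_piK.
Qed.

Lemma subquotient_map_linear : linear subquotient_map_fun.
Proof.
move=> a x y; rewrite -(subquotient_piK x) -(subquotient_piK y).
rewrite -subquotient_pi_linear !subquotient_map_pi -subquotient_pi_linear.
by congr subquotient_pi; apply: val_inj.
Qed.

HB.instance Definition _ := GRing.isLinear.Build F (subquotient Z B)
  (subquotient Z' B') *:%R subquotient_map_fun subquotient_map_linear.

(* The map [Z / B -> Z' / B'] induced by the identity of [W]. *)
Definition subquotient_map : {linear subquotient Z B -> subquotient Z' B'} :=
  subquotient_map_fun.

End subquotient_map.

(** * Simplicial homology *)

Record simplicialComplex (T : choiceType) := SimplicialComplex {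
  simplex :> set {fset T};
  simplex_neq0 : forall s, simplex s -> s != fset0;
  simplex_face : forall s t : {fset T},
    simplex s -> (t `<=` s)%fset -> t != fset0 -> simplex t
}.

Section chains.
Context (F : fieldType) {T : choiceType}.

Notation chainFun n := (n.+1.-tuple T -> F^o).

(* Oriented [n]-chains, as finitely supported alternating functions on ordered
   [n]-simplices: [c] stands for the sum of the [c v] times the oriented simplex
   [v_0, ..., v_n], over the [n]-simplices of [K] with one ordering [v] chosen
   for each. *)
Definition chain (K : simplicialComplex T) (n : nat) : set (chainFun n) :=
  [set c | [/\ finite_set [set v | c v != 0],
               forall v : n.+1.-tuple T, c v != 0 ->
                 uniq v /\ simplex K [fset x in tval v]%fset &
               forall (v : n.+1.-tuple T) (s : 'S_n.+1),
                 c [tuple tnth v (s i) | i < n.+1] = (-1) ^+ s * c v]].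

(* The oriented face [w_0, ..., w_n] occurs with coefficient [1] in the boundary
   of [x, w_0, ..., w_n]; [boundary_oriented] below is the usual formula. *)
Definition boundary (n : nat) (c : chainFun n.+1) : chainFun n :=
  fun w => \sum_(x \in [set: T]) c [tuple of x :: w].

Definition cycle_pred (K : simplicialComplex T) (n : nat) :
    {pred chainFun n} :=
  match n with
  | 0 => fun c => `[< chain K c >]
  | m.+1 => fun c => `[< chain K c /\ boundary c = 0 >]
  end.

Definition boundary_pred (K : simplicialComplex T) (n : nat) :
    {pred chainFun n} :=
  fun c => `[< exists2 b : chainFun n.+1, chain K b & c = boundary b >].

(* The oriented simplex [v_0, ..., v_n]: the signature of [s] at
   [v_(s 0), ..., v_(s n)], and zero away from the reorderings of [v]. *)
Definition oriented (n : nat) (v : n.+1.-tuple T) : chainFun n :=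
  fun w => \det (\matrix_(i, j) (tnth v i == tnth w j)%:R : 'M[F]_n.+1).

Lemma boundary_oriented (n : nat) (v : n.+2.-tuple T) :
  boundary (oriented v) =
  \sum_(i < n.+2) (-1) ^+ i *: oriented [tuple tnth v (lift i j) | j < n.+1].
Proof.
apply/funext => w; rewrite /boundary.
rewrite (fsbigTE [fset x in tval v]%fset); last first.
  move=> x; rewrite inE /= => xv; rewrite /oriented (expand_det_col _ ord0).
  apply: big1 => i _; rewrite mxE tnth0.
  by case: eqP => [vx|_]; rewrite ?mul0r//; rewrite -vx mem_tnth in xv.
under eq_bigr do rewrite /oriented (expand_det_col _ ord0).
rewrite exchange_big /= fct_sumE; apply: eq_bigr => i _.
rewrite (big_fsetD1 (tnth v i)) /=; last by rewrite inE/= mem_tnth.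
rewrite big_seq big1 ?addr0 => [|x]; last first.
  by rewrite !inE => /andP[xv _]; rewrite mxE tnth0 eq_sym (negPf xv) mul0r.
rewrite mxE tnth0 eqxx mul1r /cofactor addn0; congr (_ * \det _).
by apply/matrixP => a b; rewrite !mxE !tnthS tnth_mktuple.
Qed.

Lemma chain_vertices (K : simplicialComplex T) n (c : chainFun n) :
  chain K c ->
  exists A : {fset T}, forall v, c v != 0 -> {subset v <= A}.
Proof.
case=> cfin _ _; have [A AE] := finite_fsetP.1 cfin.
exists (\big[fsetU/fset0]_(v <- A) [fset x in tval v])%fset => v cv x xv.
have vA : v \in A by have : [set v | c v != 0] v := cv; rewrite AE.
by apply/bigfcupP; exists v; rewrite ?vA// inE.
Qed.

Lemma boundaryE n (c : chainFun n.+1) (A : {fset T}) :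
  (forall v, c v != 0 -> {subset v <= A}) ->
  boundary c = fun w => \sum_(x <- A) c [tuple of x :: w].
Proof.
move=> cA; apply/funext => w; rewrite /boundary (fsbigTE A)// => x.
by apply: contraNeq => /cA; apply; rewrite mem_head.
Qed.

Lemma boundary_neq0 n (c : chainFun n.+1) w :
  boundary c w != 0 -> exists x, c [tuple of x :: w] != 0.
Proof.
apply: contra_neqP => /forallNP cw0; apply: fsbig1 => x _.
by apply/eqP; apply: contra_notT (cw0 x).
Qed.

Lemma boundary_chain K n (c : chainFun n.+1) : chain K c -> chain K (boundary c).
Proof.
move=> cK; have [A cA] := chain_vertices cK; case: (cK) => cfin cs calt.
split=> [|w /boundary_neq0[x cxw]|w s].
- apply: (@sub_finite_set _ _ ((fun v => [tuple of behead v]) @`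
      [set v | c v != 0])); last exact: finite_image.
  by move=> w /= /boundary_neq0[x cxw]; exists [tuple of x :: w] => //; exact: val_inj.
- have [/= /andP[_ wu] xwK] := cs _ cxw; split=> //; apply: simplex_face xwK _ _.
    by apply/fsubsetP => y; rewrite !inE /= => yw; rewrite ?inE yw orbT.
  by apply/fset0Pn; exists (tnth w ord0); rewrite inE /= mem_tnth.
- rewrite (boundaryE cA) mulr_sumr; apply: eq_bigr => x _.
  have := calt [tuple of x :: w] (lift_perm ord0 ord0 s).
  rewrite odd_lift_perm /= => <-; congr c.
  apply: eq_from_tnth => i; rewrite tnth_mktuple.
  case: (unliftP ord0 i) => [j ->|->]; last by rewrite lift_perm_id !tnth0.
  by rewrite lift_perm_lift !tnthS tnth_mktuple.
Qed.

Lemma chain_swap K n (c : chainFun n.+2) x y (w : n.+1.-tuple T) : chain K c ->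
  c [tuple of x :: y :: w] = - c [tuple of y :: x :: w].
Proof.
move=> [_ _ calt].
have := calt [tuple of y :: x :: w] (tperm ord0 (lift ord0 ord0)).
rewrite odd_tperm /= expr1 mulN1r => <-; congr c.
apply: eq_from_tnth => i; rewrite tnth_mktuple.
case: tpermP => [->|->|]; rewrite ?tnthS ?tnth0//.
case: (unliftP ord0 i) => [j ->|->//] _.
case: (unliftP ord0 j) => [h ->|->//] _.
by rewrite !tnthS.
Qed.

Lemma boundary_boundary K n (c : chainFun n.+2) : chain K c ->
  boundary (boundary c) = 0.
Proof.
move=> cK; have [A cA] := chain_vertices cK.
have bA v : boundary c v != 0 -> {subset v <= A}.
  by move=> /boundary_neq0[x /cA cv] y yv; apply: cv; rewrite inE yv orbT.
rewrite (boundaryE bA) (boundaryE cA); apply/funext => w.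
have [g gE] : exists g, g = fun x y : T => c [tuple of y :: x :: w] by eexists.
transitivity (\sum_(x <- A) \sum_(y <- A) g x y).
  by rewrite gE.
have gN x y : g x y = - g y x by rewrite gE (chain_swap _ _ _ cK).
have g0 x : g x x = 0.
  rewrite gE; apply/eqP/negPn/negP => cxx; case: cK => _ /(_ _ cxx)[xx _] _.
  by rewrite /= mem_head in xx.
elim: {cA bA gE}(A : seq T) => [|x s IHs]; first by rewrite big_nil.
under eq_bigr do rewrite big_cons.
rewrite big_cons big_split /= g0 add0r IHs addr0.
by under [X in _ + X]eq_bigr do rewrite gN; rewrite sumrN subrr.
Qed.

Lemma chain0 K n : chain K (0 : chainFun n).
Proof.
split=> [|v|v s]; last by symmetry; exact: mulr0.
  by rewrite (_ : [set _ | _] = set0)// -subset0 => v /=; rewrite eqxx.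
by rewrite eqxx.
Qed.

Lemma chainD K n (b c : chainFun n) : chain K b -> chain K c -> chain K (b + c).
Proof.
have bcE v : (b + c) v = b v + c v by [].
have bc0 v : (b + c) v != 0 -> b v != 0 \/ c v != 0.
  move=> bcv; have [b0|] := eqVneq (b v) 0; last by left.
  by right; apply: contra_neq bcv => c0; rewrite bcE b0 c0 addr0.
move=> [bfin bK bS] [cfin cK cS]; split=> [|v /bc0[/bK|/cK]//|v s].
  apply: (@sub_finite_set _ _ ([set v | b v != 0] `|` [set v | c v != 0])).
    by move=> v /= /bc0.
  by rewrite finite_setU.
by rewrite !bcE bS cS -mulrDr.
Qed.

Lemma chainZ K n (a : F) (c : chainFun n) : chain K c -> chain K (a *: c).
Proof.
have acE v : (a *: c) v = a * c v by [].
have ac0 v : (a *: c) v != 0 -> c v != 0.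
  by apply: contra_neq => c0; rewrite acE c0 mulr0.
move=> [cfin cK cS]; split=> [|v /ac0/cK//|v s].
  by apply: sub_finite_set cfin => v /= /ac0.
by rewrite !acE cS mulrCA.
Qed.

Lemma boundary0 n : boundary (0 : chainFun n.+1) = 0.
Proof. by apply/funext => w; rewrite /boundary fsbig1. Qed.

Lemma boundaryD K n (b c : chainFun n.+1) : chain K b -> chain K c ->
  boundary (b + c) = boundary b + boundary c.
Proof.
move=> bK cK; have [A bA] := chain_vertices bK; have [A' cA'] := chain_vertices cK.
have bE : forall v, b v != 0 -> {subset v <= (A `|` A')%fset}.
  by move=> v /bA vA x /vA xA; rewrite inE xA.
have cE : forall v, c v != 0 -> {subset v <= (A `|` A')%fset}.
  by move=> v /cA' vA x /vA xA; rewrite inE xA orbT.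
have [A2 bcA] := chain_vertices (chainD bK cK).
rewrite (@boundaryE _ b (A `|` A')%fset)// (@boundaryE _ c (A `|` A')%fset)//.
rewrite (@boundaryE _ (b + c) (A `|` A')%fset); last first.
  move=> v bcv; have [b0|/bE//] := eqVneq (b v) 0; apply: cE.
  apply: contra_neq bcv => c0.
  by rewrite (_ : (b + c) v = b v + c v)// b0 c0 addr0.
by apply/funext => w; rewrite big_split.
Qed.

Lemma boundaryZ n (a : F) (c : chainFun n.+1) :
  boundary (a *: c) = a *: boundary c.
Proof. by apply/funext => w; rewrite [RHS]mulr_fsumr. Qed.

Lemma cycle_pred_closed K n : GRing.subsemimod_closed (@cycle_pred K n).
Proof.
case: n => [|n]; (split; [split|]).
- exact/asboolP/chain0.
- by move=> b c /asboolP bK /asboolP cK; apply/asboolP/chainD.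
- by move=> a c /asboolP cK; apply/asboolP/chainZ.
- by apply/asboolP; split; [exact: chain0 | exact: boundary0].
- move=> b c /asboolP[bK b0] /asboolP[cK c0]; apply/asboolP.
  by split; [exact: chainD | rewrite (boundaryD bK cK) b0 c0 addr0].
- move=> a c /asboolP[cK c0]; apply/asboolP.
  by split; [exact: chainZ | rewrite boundaryZ c0 scaler0].
Qed.

Lemma boundary_pred_closed K n : GRing.subsemimod_closed (@boundary_pred K n).
Proof.
split; [split|].
- by apply/asboolP; exists 0; [exact: chain0 | rewrite boundary0].
- move=> _ _ /asboolP[b bK ->] /asboolP[c cK ->]; apply/asboolP.
  by exists (b + c); [exact: chainD | rewrite (boundaryD bK cK)].
- move=> a _ /asboolP[c cK ->]; apply/asboolP.
  by exists (a *: c); [exact: chainZ | rewrite boundaryZ].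
Qed.

Lemma boundary_cycle K n : {subset @boundary_pred K n <= @cycle_pred K n}.
Proof.
case: n => [|n] _ /asboolP[b bK ->]; apply/asboolP; first exact: boundary_chain.
by split; [exact: boundary_chain | exact: boundary_boundary bK].
Qed.

HB.instance Definition _ K n := GRing.isSubmodClosed.Build F (chainFun n)
  (@cycle_pred K n) (cycle_pred_closed K n).
HB.instance Definition _ K n := GRing.isSubmodClosed.Build F (chainFun n)
  (@boundary_pred K n) (boundary_pred_closed K n).

Definition homology (K : simplicialComplex T) (n : nat) : lmodType F :=
  subquotient (@cycle_pred K n) (@boundary_pred K n).

Section inclusion.
Variables (K L : simplicialComplex T) (n : nat).
Hypothesis KL : K `<=` L.

Lemma chain_sub m : @chain K m `<=` @chain L m.
Proof. by move=> c [cfin cK cS]; split=> // v /cK[? /KL]. Qed.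

Lemma cycle_pred_sub : {subset @cycle_pred K n <= @cycle_pred L n}.
Proof.
case: n => [|m] c.
  by move=> /asboolP cK; apply/asboolP; exact: chain_sub.
by move=> /asboolP[cK c0]; apply/asboolP; split=> //; exact: chain_sub.
Qed.

Lemma boundary_pred_sub : {subset @boundary_pred K n <= @boundary_pred L n}.
Proof.
move=> _ /asboolP[b bK ->]; apply/asboolP; exists b => //.
exact: chain_sub.
Qed.

Definition homology_incl : {linear homology K n -> homology L n} :=
  subquotient_map cycle_pred_sub boundary_pred_sub.

End inclusion.

Lemma homology_incl_id (K : simplicialComplex T) n (KK : K `<=` K) x :
  homology_incl n KK x = x.
Proof.
rewrite -(subquotient_piK x) [LHS](subquotient_map_pi _ (boundary_pred_sub KK)).
by congr subquotient_pi; apply: val_inj.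
Qed.

Lemma homology_incl_comp (K L M : simplicialComplex T) n
    (KL : K `<=` L) (LM : L `<=` M) (KM : K `<=` M) x :
  homology_incl n LM (homology_incl n KL x) = homology_incl n KM x.
Proof.
rewrite -(subquotient_piK x) [in LHS]/homology_incl /=.
rewrite (subquotient_map_pi _ (boundary_pred_sub KL)).
rewrite (subquotient_map_pi _ (boundary_pred_sub LM)).
rewrite [RHS](subquotient_map_pi _ (boundary_pred_sub KM)).
by congr subquotient_pi; apply: val_inj.
Qed.

End chains.

(** * Vietoris-Rips complexes and labeled persistent homology *)

Section vietoris_rips.
Context {R : realType} {X : metricType R}.

Definition diam (A : set X) : \bar R :=
  ereal_sup [set (mdist x y)%:E | x in A & y in A].

Definition VR_simplex (r : R) (A : set X) : set {fset X} :=
  [set s | [/\ s != fset0, [set` s] `<=` A & (diam [set` s] <= r%:E)%E]].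

Lemma VR_simplex_neq0 r A s : VR_simplex r A s -> s != fset0.
Proof. by case. Qed.

Lemma diam_sub (A B : set X) : A `<=` B -> (diam A <= diam B)%E.
Proof.
move=> AB; apply: ereal_sup_le => _ [x Ax [y Ay <-]].
by exists x; [exact: AB | exists y; [exact: AB |]].
Qed.

Lemma VR_simplex_face r A (s t : {fset X}) : VR_simplex r A s ->
  (t `<=` s)%fset -> t != fset0 -> VR_simplex r A t.
Proof.
move=> [_ sA sr] /fsubsetP ts t0; split=> //; first by move=> x /ts /sA.
by apply: le_trans sr; apply: diam_sub.
Qed.

(* The Vietoris-Rips complex of the subspace [A] of [X]. *)
Definition VR (r : R) (A : set X) : simplicialComplex X :=
  {| simplex := VR_simplex r A;
     simplex_neq0 := @VR_simplex_neq0 r A;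
     simplex_face := @VR_simplex_face r A |}.

Lemma VR_sub (r s : R) (A B : set X) : r <= s -> A `<=` B ->
  VR r A `<=` VR s B.
Proof.
move=> rs AB t [t0 tA tr]; split=> //; first exact: subset_trans tA AB.
by rewrite (le_trans tr)// lee_fin.
Qed.

End vietoris_rips.

Section labeled_persistent_homology.
Context {R : realType} (F : fieldType) {k : nat}.
Variables (j : nat) (X : labeledMetricSpace R k).
Implicit Types x y z : R *p {set 'I_k}.

Definition label_union (p : {set 'I_k}) : set X :=
  \bigcup_(i in [set` p]) lms_label X i.

Definition LPH_complex x : simplicialComplex X := VR x.1 (label_union x.2).

Lemma LPH_complex_sub x y : (x <= y)%O -> LPH_complex x `<=` LPH_complex y.
Proof.
rewrite leEprod => /andP[xy1 xy2]; apply: VR_sub => //.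
by apply: bigcup_subset => i; exact: fintype.subsetP xy2 i.
Qed.

Definition LPH : pmodule F (R *p {set 'I_k}) :=
  {| pm_obj := fun x => homology F (LPH_complex x) j;
     pm_map := fun x y xy => homology_incl F j (LPH_complex_sub xy);
     pm_map_id := fun x xx v => homology_incl_id (LPH_complex_sub xx) v;
     pm_map_comp := fun x y z xy yz xz v =>
       homology_incl_comp (LPH_complex_sub xy) (LPH_complex_sub yz)
         (LPH_complex_sub xz) v |}.

End labeled_persistent_homology.

(* Main.v *)
(* A tuple of correspondences C_1, ..., C_q of distortion at most e yields, for
   each set p of labels, a correspondence between the unions of the subsets with
   labels in p, hence a map f_p that is simplicial from VR_r to VR_(r+e). Any two
   choices of points in the correspondence are contiguous, and so induce the same
   map on homology; this gives both the naturality in p and the interleaving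
   identities.
   Chains being alternating functions on ordered simplices, a map f acts on them
   by summing over the fibers of f. To see that contiguous maps f and g agree on
   the homology class of a cycle c, change f into g one vertex at a time; when f
   and g only differ at a vertex a, the cycle f# c - g# c is the boundary of its
   cone with apex g(a). *)

Require Import Defs.
From HB Require Import structures.
From mathcomp Require Import all_boot all_order all_algebra.
From mathcomp Require Import perm finmap.
From mathcomp Require Import all_classical all_reals all_analysis.

Set Implicit Arguments.
Unset Strict Implicit.
Unset Printing Implicit Defensive.

Import Order.TTheory GRing.Theory Num.Theory.
Import Order.DefaultSetSubsetOrder.

Local Open Scope classical_set_scope.
Local Open Scope ring_scope.

(* The absence of fixed points makes this hold in characteristic 2 as well. *)
Lemma big_fset_involution (V : choiceType) (Z : zmodType) (S : {fset V})
    (t : V -> V) (G : V -> Z) :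
  (forall v, v \in S -> t v \in S) -> involutive t ->
  (forall v, v \in S -> t v != v) -> (forall v, v \in S -> G (t v) = - G v) ->
  \sum_(v <- S) G v = 0.
Proof.
move=> + tK; have [n] := ubnP #|` S|; elim: n S => // n IHn S Sn tS tN GN.
have [->|/fset0Pn[v vS]] := eqVneq S fset0; first by rewrite big_seq_fset0.
have tvS : t v \in (S `\ v)%fset by rewrite !inE tN//= tS.
rewrite (big_fsetD1 v)//= (big_fsetD1 (t v))//= GN// addrA subrr add0r.
have sub : (S `\ v `\ t v `<=` S)%fset.
  by rewrite (fsubset_trans (fsubsetDl _ _))// fsubsetDl.
apply: IHn => [|u|u|u]; last 2 first.
- by move=> /(fsubsetP sub); exact: tN.
- by move=> /(fsubsetP sub); exact: GN.
- apply: leq_trans (_ : #|` S| <= n)%N; last by [].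
  rewrite (cardfsD1 v S) vS ltnS.
  by apply: fsubset_leq_card; exact: fsubsetDl.
- rewrite !inE => /and3P[utv uv uS]; rewrite tS// andbT.
  by rewrite (inj_eq (inv_inj tK)) uv (can2_eq tK tK) utv.
Qed.

(** * Summation over the fibers of a map *)

Section push.
Context {F : fieldType}.

Definition push (V W : choiceType) (h : V -> W) (c : V -> F^o) : W -> F^o :=
  fun w => \sum_(v \in [set v | h v = w]) c v.

Definition supported (V : choiceType) (c : V -> F^o) (S : {fset V}) :=
  forall v, c v != 0 -> v \in S.

Lemma finite_supported (V : choiceType) (c : V -> F^o) :
  finite_set [set v | c v != 0] -> exists S, supported c S.
Proof.
by move=> /finite_fsetP[S SE]; exists S => v cv; have : [set` S] v by rewrite -SE.
Qed.

Lemma supported_finite (V : choiceType) (c : V -> F^o) S :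
  supported c S -> finite_set [set v | c v != 0].
Proof. by move=> cS; apply: (@sub_finite_set _ _ [set` S]) => // v /cS. Qed.

Lemma supportedW (V : choiceType) (c : V -> F^o) (S S' : {fset V}) :
  (S `<=` S')%fset -> supported c S -> supported c S'.
Proof. by move=> /fsubsetP SS' cS v /cS/SS'. Qed.

Section push_theory.
Context {V W : choiceType}.
Implicit Types (h : V -> W) (c : V -> F^o).

Lemma pushE h c S w : supported c S ->
  push h c w = \sum_(v <- S | h v == w) c v.
Proof.
move=> cS; rewrite /push fsbig_mkcond (fsbigTE S) => [|v vS]; last first.
  by rewrite patchE; case: ifP => // _; apply/eqP; apply: contraNT vS => /cS.
rewrite [RHS]big_mkcond; apply: eq_bigr => v _; rewrite patchE.
by case: eqP => hv; case: ifPn => //; rewrite ?inE// notin_setE.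
Qed.

Lemma push_neq0 h c w : push h c w != 0 -> exists2 v, h v = w & c v != 0.
Proof.
apply: contra_neqP => H; apply: fsbig1 => v hv; apply/eqP.
by apply: contra_notT H => cv; exists v.
Qed.

Lemma push_supported h c S : supported c S -> supported (push h c) (h @` S)%fset.
Proof. by move=> cS w /push_neq0[v <- /cS vS]; rewrite in_imfset. Qed.

Lemma push_finite h c : finite_set [set v | c v != 0] ->
  finite_set [set w | push h c w != 0].
Proof. by move=> /finite_supported[S /(@push_supported h)/supported_finite]. Qed.

Lemma push_bij h (h' : W -> V) c : cancel h h' -> cancel h' h -> push h c = c \o h'.
Proof.
move=> hK h'K; apply/funext => w; rewrite /push.
rewrite (_ : [set v | h v = w] = [set h' w]) ?fsbig_set1//.
by apply/seteqP; split=> v /=; [move=> <-; rewrite hK | move=> ->; rewrite h'K].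
Qed.

Lemma push_linear a b c h : finite_set [set v | b v != 0] ->
  finite_set [set v | c v != 0] -> push h (a *: b + c) = a *: push h b + push h c.
Proof.
move=> /finite_supported[S bS] /finite_supported[S' cS']; apply/funext => w.
have bU := supportedW (fsubsetUl S S') bS.
have cU := supportedW (fsubsetUr S S') cS'.
have acU : supported (a *: b + c) (S `|` S')%fset.
  move=> v; apply: contraNT => vU.
  have b0 : b v = 0 by apply/eqP; apply: contraNT vU => /bU.
  have c0 : c v = 0 by apply/eqP; apply: contraNT vU => /cU.
  by rewrite (_ : (_ + _) v = a * b v + c v)// b0 c0 mulr0 addr0.
rewrite (pushE _ _ acU) (_ : (_ + _) w = a * push h b w + push h c w)//.
by rewrite (pushE _ _ bU) (pushE _ _ cU) mulr_sumr -big_split.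
Qed.

Lemma eq_push h g c : (forall v, c v != 0 -> h v = g v) -> push h c = push g c.
Proof.
move=> hg; apply/funext => w; rewrite /push fsbig_supp [RHS]fsbig_supp.
apply: eq_fsbigl; apply/seteqP; split=> v /= [vw /eqP cv]; split=> //; try exact/eqP.
  by rewrite -hg.
by rewrite hg.
Qed.

End push_theory.

Lemma push_id (V : choiceType) (c : V -> F^o) : push id c = c.
Proof. exact: (@push_bij _ _ id id). Qed.

Lemma push_comp (U V W : choiceType) (h : U -> V) (g : V -> W) c :
  finite_set [set v | c v != 0] -> push g (push h c) = push (g \o h) c.
Proof.
move=> /finite_supported[S cS]; apply/funext => w.
rewrite (pushE _ _ (push_supported cS)) (pushE _ _ cS).
under eq_bigr do rewrite (pushE _ _ cS).
rewrite (exchange_big_dep (fun v => g (h v) == w))/=; last first.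
  by move=> u v /eqP <- /eqP ->.
rewrite big_seq_cond [RHS]big_seq_cond; apply: eq_bigr => v /andP[vS /eqP gw].
(* A given [v] contributes only at the intermediate point [h v]. *)
rewrite (eq_bigl (pred1 (h v))) => [|u]; last first.
  by rewrite /= [in RHS]eq_sym; case: (h v =P u) => [<-|]; rewrite ?gw ?eqxx ?andbF.
by rewrite (fbig_pred1_inj (k := id))// in_imfset.
Qed.

End push.

(** * Cones *)

Section alternating.
Context {F : fieldType} {T : choiceType}.

Definition tuple_perm (n : nat) (v : n.-tuple T) (s : 'S_n) : n.-tuple T :=
  [tuple tnth v (s i) | i < n].

Definition alternating (n : nat) (c : n.-tuple T -> F^o) :=
  forall v s, c (tuple_perm v s) = (-1) ^+ s * c v.

Lemma tuple_permM n (v : n.-tuple T) (s t : 'S_n) :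
  tuple_perm (tuple_perm v s) t = tuple_perm v (t * s)%g.
Proof. by apply: eq_from_tnth => i; rewrite !tnth_mktuple permM. Qed.

Lemma tuple_perm1 n (v : n.-tuple T) : tuple_perm v 1 = v.
Proof. by apply: eq_from_tnth => i; rewrite !tnth_mktuple perm1. Qed.

Lemma tuple_perm_bij n (s : 'S_n) : bijective ((@tuple_perm n)^~ s).
Proof.
by exists ((@tuple_perm n)^~ s^-1%g) => v;
  rewrite tuple_permM ?mulVg ?mulgV tuple_perm1.
Qed.

Lemma tuple_nuniqP n (v : n.-tuple T) : ~~ uniq v ->
  exists i j, i != j /\ tnth v i = tnth v j.
Proof.
apply: contraNP => H; apply/tuple_uniqP => i j vij.
by apply/eqP; apply: contra_notT H => ij; exists i, j.
Qed.

Lemma fset_tuple_neq0 n (v : n.+1.-tuple T) : [fset x in tval v]%fset != fset0.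
Proof. by apply/fset0Pn; exists (tnth v ord0); rewrite inE /= mem_tnth. Qed.

Definition tuple_del (n : nat) (v : n.+1.-tuple T) (i : 'I_n.+1) : n.-tuple T :=
  [tuple tnth v (lift i j) | j < n].

(** [s] induces a bijection between the complements of [i] and of [s i]; [r] is its renumbering, so
    [s = lift_perm i (s i) r] and the signs follow. *)
Lemma tuple_del_perm n (s : 'S_n.+1) (i : 'I_n.+1) :
  exists2 r : 'S_n, forall v,
    tuple_del (tuple_perm v s) i = tuple_perm (tuple_del v (s i)) r
    & (-1) ^+ r = (-1) ^+ (s : bool) * (-1) ^+ i * (-1) ^+ (s i) :> F.
Proof.
have sl j : s i != s (lift i j) by rewrite (inj_eq perm_inj) neq_lift.
have [r rE] : {r : 'S_n | forall j, s (lift i j) = lift (s i) (r j)}.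
  pose g j := sval (unlift_some (sl j)).
  have gE j : s (lift i j) = lift (s i) (g j) by rewrite /g; case: unlift_some.
  have ginj : injective g.
    move=> j k gjk; have := gE k; rewrite -gjk -gE => /perm_inj/lift_inj.
    by [].
  by exists (perm ginj) => j; rewrite permE.
have sE : s = lift_perm i (s i) r.
  apply/permP => j; case: (unliftP i j) => [k ->|->].
    by rewrite lift_perm_lift rE.
  by rewrite lift_perm_id.
exists r => [v|]; first by apply: eq_from_tnth => j; rewrite !tnth_mktuple rE.
rewrite [in X in _ = X * _ * _]sE odd_lift_perm -(signr_odd _ i).
rewrite -(signr_odd _ (s i)) -!signr_addb.
by case: (odd i) (odd (s i)) (odd_perm r) => [] [] [].
Qed.

(* The join of the vertex [z] with [c]; the simplices of [c] that contain [z] do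
   not contribute to it. *)
Definition cone (n : nat) (z : T) (c : n.-tuple T -> F^o) : n.+1.-tuple T -> F^o :=
  fun w => \sum_(i < n.+1 | tnth w i == z) (-1) ^+ i * c (tuple_del w i).

(** The sign of the induced permutation trades [(-1) ^+ i] for [(-1) ^+ (s i)]: permuting [w]
    permutes the terms of the cone, up to the sign of [s]. *)
Lemma cone_term_perm n (c : n.-tuple T -> F^o)
    (w : n.+1.-tuple T) (s : 'S_n.+1) (i : 'I_n.+1) :
  alternating c ->
  (-1) ^+ i * c (tuple_del (tuple_perm w s) i) =
  (-1) ^+ s * ((-1) ^+ (s i) * c (tuple_del w (s i))).
Proof.
move=> calt; have [r -> rE] := tuple_del_perm s i; rewrite calt rE !mulrA.
rewrite [_ ^+ i * _]mulrC -!mulrA; congr (_ * _).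
by rewrite mulrA -expr2 sqrr_sign mul1r.
Qed.

Lemma cone_alternating n (z : T) (c : n.-tuple T -> F^o) :
  alternating c -> alternating (cone z c).
Proof.
move=> calt w s; rewrite /cone mulr_sumr [RHS](reindex_perm s)/=.
by apply: eq_big => [i|i _]; rewrite ?tnth_mktuple// cone_term_perm.
Qed.

(** If entries [i] and [j] of [w] agree, deleting a third entry leaves the repetition, so [c]
    vanishes there; the terms [i] and [j] are swapped by a transposition and cancel. *)
Lemma cone_uniq n (z : T) (c : n.-tuple T -> F^o) :
  alternating c -> (forall v, c v != 0 -> uniq v) ->
  forall w, cone z c w != 0 -> uniq w.
Proof.
move=> calt cu w; apply: contraNT => /tuple_nuniqP[i [j [ij wij]]].
have wt : tuple_perm w (tperm i j) = w.
  by apply: eq_from_tnth => k; rewrite tnth_mktuple; case: tpermP => [->|->|].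
have c0 k : k != i -> k != j -> c (tuple_del w k) = 0.
  move=> ki kj; apply/eqP/negPn/negP => /cu/tuple_uniqP inj.
  have [i' iE _] := unlift_some ki; have [j' jE _] := unlift_some kj.
  have /inj : tnth (tuple_del w k) i' = tnth (tuple_del w k) j'.
    by rewrite !tnth_mktuple -iE -jE.
  by move=> ij'; move: ij; rewrite iE jE ij' eqxx.
rewrite /cone big_mkcond (bigD1 i)//= (bigD1 j)/=; last by rewrite eq_sym.
rewrite big1 ?addr0 => [|k /andP[ki kj]]; last by rewrite c0// mulr0 if_same.
have := cone_term_perm w (tperm i j) i calt; rewrite wt => ->.
rewrite odd_tperm ij tpermL wij expr1 mulN1r.
by case: ifP; rewrite ?addr0// addNr.
Qed.

Lemma cone_neq0 n z (c : n.-tuple T -> F^o) w : cone z c w != 0 ->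
  exists2 i, tnth w i = z & c (tuple_del w i) != 0.
Proof.
apply: contra_neqP => H; apply: big1 => i /eqP wi; apply/eqP.
by rewrite mulf_eq0 signr_eq0/=; apply: contra_notT H => ci; exists i.
Qed.

Lemma cone_finite n z (c : n.-tuple T -> F^o) :
  finite_set [set v | c v != 0] -> finite_set [set w | cone z c w != 0].
Proof.
(* [ins u i] inserts [z] at position [i], which undoes [tuple_del]. *)
move=> cfin; pose ins (u : n.-tuple T) (i : 'I_n.+1) : n.+1.-tuple T :=
  [tuple if unlift i j is Some k then tnth u k else z | j < n.+1].
apply: (@sub_finite_set _ _ [set ins u i | u in [set v | c v != 0] & i in setT]).
  move=> w /= /cone_neq0[i wi cw]; exists (tuple_del w i) => //; exists i => //.
  apply: eq_from_tnth => j; rewrite !tnth_mktuple.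
  by case: unliftP => [k ->|->]; rewrite ?tnth_mktuple.
exact: finite_image2.
Qed.

(** The boundary of a cone is its base minus the cone over the boundary of the base, which vanishes
    here. With a sum over [x] in place of [boundary], tuples of length one are covered too: the
    hypothesis then says that the coefficients sum to zero. *)
Lemma sum_cone_cons n z (c : n.+1.-tuple T -> F^o) (w : n.+1.-tuple T) :
  finite_set [set v | c v != 0] ->
  (forall u : n.-tuple T, \sum_(x \in [set: T]) c [tuple of x :: u] = 0) ->
  \sum_(x \in [set: T]) cone z c [tuple of x :: w] = c w.
Proof.
move=> /finite_supported[S cS] c0.
pose A := (z |` \bigcup_(v <- S) [fset x in tval v])%fset.
have cA (v : n.+1.-tuple T) x : c v != 0 -> x \in tval v -> x \in A.
  move=> cv xv; rewrite !inE; apply/orP; right.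
  by apply/bigfcupP; exists v; rewrite ?inE ?cS.
have delS x (i : 'I_n.+1) :
    tuple_del [tuple of x :: w] (lift ord0 i) = [tuple of x :: tuple_del w i].
  apply: eq_from_tnth => j; rewrite !tnth_mktuple.
  case: (unliftP ord0 j) => [k ->|->]; last first.
    by rewrite [RHS]tnth0 (_ : lift _ _ = ord0) ?tnth0//; exact: val_inj.
  rewrite tnthS tnth_mktuple -[tnth w _](tnthS x); congr tnth.
  by apply: val_inj; rewrite /= /bump !leq0n !add1n ltnS addnS.
have del0 x : tuple_del [tuple of x :: w] ord0 = w.
  by apply: eq_from_tnth => j; rewrite tnth_mktuple tnthS.
rewrite (fsbigTE A) => [|x xA]; last first.
  apply/eqP; apply: contraNT xA => /cone_neq0[i].
  case: (unliftP ord0 i) => [j ->|->]; last first.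
    by rewrite tnth0 => -> _; rewrite !inE eqxx.
  by rewrite delS => _ /cA; apply; rewrite mem_head.
(* Position 0 deletes [x] and counts only for [x = z], which gives [c w]; at other positions [x]
   heads the face, and summing over [x] gives zero by [c0]. *)
under eq_bigr do rewrite /cone big_mkcond big_ord_recl /= tnth0 del0 expr0 mul1r.
rewrite big_split /= [X in X + _](_ : _ = c w); last first.
  by rewrite -big_mkcond (fbig_pred1_inj (k := id))// !inE eqxx.
rewrite exchange_big big1 ?addr0// => i _.
under eq_bigr do rewrite tnthS delS.
case: eqP => [_|_]; last by rewrite big1.
rewrite -mulr_sumr -(fsbigTE A (fun x => c [tuple of x :: tuple_del w i])).
  by rewrite c0 mulr0.
move=> x xA; apply/eqP; apply: contraNT xA => /cA; apply; exact: mem_head.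
Qed.

End alternating.

(** * Contiguous maps *)

Section chain_map.
Context {F : fieldType}.

Definition tuple_behead (T : Type) n (v : n.+1.-tuple T) : n.-tuple T :=
  [tuple of behead v].

(** Simplices collapsed by [f] are not discarded: for a chain [c] their contributions cancel, as
    [chain_map_chain] shows. *)
Definition chain_map (T T' : choiceType) (f : T -> T') (n : nat)
    (c : n.-tuple T -> F^o) : n.-tuple T' -> F^o :=
  push (fun v : n.-tuple T => [tuple of map f v]) c.

(** The first entry parametrizes the fiber of [tuple_behead]. At [n = 0] this is the
    augmentation. *)
Lemma sum_cons (T : choiceType) n (c : n.+1.-tuple T -> F^o) (w : n.-tuple T) :
  \sum_(x \in [set: T]) c [tuple of x :: w] =
  push (@tuple_behead T n) c w.
Proof.
rewrite /push [RHS](reindex_fsbig (fun x : T => [tuple of x :: w]) setT)//.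
split=> [x _ /=|x y _ _ /(congr1 val)[]//|v /= <-]; first exact: val_inj.
by exists (thead v) => //; rewrite [RHS]tuple_eta; exact: val_inj.
Qed.

(** In this form, commutation with chain maps reduces to functoriality of [push]. *)
Lemma boundary_push (T : choiceType) n (c : n.+2.-tuple T -> F^o) :
  boundary c = push (@tuple_behead T n.+1) c.
Proof. by apply/funext => w; exact: sum_cons. Qed.

Lemma chain_map_behead (T T' : choiceType) (f : T -> T') n
    (c : n.+1.-tuple T -> F^o) : finite_set [set v | c v != 0] ->
  push (@tuple_behead T' n) (chain_map f c) =
  chain_map f (push (@tuple_behead T n) c).
Proof.
move=> cfin; rewrite /chain_map !push_comp//; apply: eq_push => v _.
by apply: val_inj; rewrite /= behead_map.
Qed.

Lemma boundary_chain_map (T T' : choiceType) (f : T -> T') n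
    (c : n.+2.-tuple T -> F^o) : finite_set [set v | c v != 0] ->
  boundary (chain_map f c) = chain_map f (boundary c).
Proof.
by move=> cfin; rewrite !boundary_push chain_map_behead.
Qed.

Lemma chain_map_id (T : choiceType) n (c : n.-tuple T -> F^o) : chain_map id c = c.
Proof.
rewrite -[RHS]push_id; apply: eq_push => v _.
by apply: val_inj; rewrite /= map_id.
Qed.

Lemma chain_map_comp (T T' T'' : choiceType) (f : T -> T') (g : T' -> T'') n
    (c : n.-tuple T -> F^o) : finite_set [set v | c v != 0] ->
  chain_map g (chain_map f c) = chain_map (g \o f) c.
Proof.
move=> cfin; rewrite /chain_map push_comp//; apply: eq_push => v _.
by apply: val_inj; rewrite /= map_comp.
Qed.

Lemma eq_chain_map (T T' : choiceType) (f g : T -> T') n (c : n.-tuple T -> F^o) :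
  (forall v, c v != 0 -> {in v, f =1 g}) -> chain_map f c = chain_map g c.
Proof.
by move=> fg; apply: eq_push => v /fg/eq_in_map vfg; exact: val_inj.
Qed.

Section simplicial.
Context {T T' : choiceType}.
Variables (K : simplicialComplex T) (L : simplicialComplex T').
Implicit Types f g : T -> T'.

(* In particular, [contiguous f f] says that [f] is simplicial. *)
Definition contiguous f g :=
  forall s, simplex K s -> simplex L ((f @` s) `|` (g @` s))%fset.

Lemma fset_map_tuple f n (v : n.-tuple T) :
  [fset x in tval [tuple of map f v]]%fset = (f @` [fset x in tval v])%fset.
Proof.
apply/fsetP => y; rewrite inE /=; apply/mapP/imfsetP => -[x xv ->];
  by exists x => //; move: xv; rewrite inE.
Qed.

(** On a simplex, [h] and [h'] take values in the union of its images by [f] and [g]. This covers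
    [f] and [g] themselves and the hybrid maps that lead from one to the other. *)
Lemma contiguous_sub f g h h' :
  (forall x, h x = f x \/ h x = g x) -> (forall x, h' x = f x \/ h' x = g x) ->
  contiguous f g -> contiguous h h'.
Proof.
move=> hE h'E fg s sK; apply: (simplex_face (fg _ sK)).
  have sub k : (forall x, k x = f x \/ k x = g x) ->
      (k @` s `<=` (f @` s) `|` (g @` s))%fset.
    move=> kE; apply/fsubsetP => _ /imfsetP[x /= xs ->]; rewrite inE.
    by case: (kE x) => ->; rewrite in_imfset ?orbT.
  by rewrite fsubUset !sub.
have /fset0Pn[x xs] := simplex_neq0 sK.
by apply/fset0Pn; exists (h x); rewrite inE in_imfset.
Qed.

Lemma chain_map_chain f n (c : n.+1.-tuple T -> F^o) :
  contiguous f f -> chain K c -> chain L (chain_map f c).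
Proof.
move=> fK [cfin cK calt].
have mapp (v : n.+1.-tuple T) (s : 'S_n.+1) :
    [tuple of map f (tuple_perm v s)] = tuple_perm [tuple of map f v] s.
  by apply: eq_from_tnth => i; rewrite !(tnth_map, tnth_mktuple).
have calt' : alternating c by [].
split=> [|w fcw|w s]; first exact: push_finite.
- split; last first.
    have [v <- cv] := push_neq0 fcw; have [_ /fK] := cK _ cv.
    by rewrite fsetUid fset_map_tuple.
  (* The simplices mapped to [w] cancel in pairs when [w] has a repeated vertex. *)
  apply: contraNT fcw => /tuple_nuniqP[i [j [ij wij]]].
  have [S SE] := finite_fsetP.1 cfin.
  have cS v : (v \in S) = (c v != 0).
    apply/idP/idP => [vS|cv].
      by have : [set` S] v by []; rewrite -SE.
    by have : [set v | c v != 0] v by []; rewrite SE.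
  have cS' : supported c S by move=> v; rewrite cS.
  rewrite /chain_map (pushE _ _ cS') big_mkcond; apply/eqP.
  have wt : tuple_perm w (tperm i j) = w.
    by apply: eq_from_tnth => k; rewrite tnth_mktuple; case: tpermP => [->|->|].
  have tc v : c (tuple_perm v (tperm i j)) = - c v.
    by rewrite calt' odd_tperm ij expr1 mulN1r.
  (* Swapping entries [i] and [j] preserves the fiber over [w], because these entries of [w] agree,
     and fixes no tuple with distinct entries. *)
  apply: (@big_fset_involution _ _ _ ((@tuple_perm _ n.+1)^~ (tperm i j))).
  + by move=> v; rewrite !cS tc oppr_eq0.
  + by move=> v; rewrite tuple_permM tperm2 tuple_perm1.
  + move=> v; rewrite cS => /cK[/tuple_uniqP inj _]; apply: contra_neq ij.
    move=> /(congr1 (fun u => tnth u i)).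
    by rewrite tnth_mktuple tpermL => /inj.
  + move=> v _; rewrite mapp tc -{1}wt.
    have -> : (tuple_perm [tuple of map f v] (tperm i j) ==
        tuple_perm w (tperm i j)) = ([tuple of map f v] == w).
      exact: (inj_eq (bij_inj (tuple_perm_bij (tperm i j)))).
    by case: ifP; rewrite ?oppr0.
- change (chain_map f c (tuple_perm w s) = (-1) ^+ s * chain_map f c w).
  rewrite /chain_map /push mulr_fsumr.
  rewrite [LHS](reindex_fsbig ((@tuple_perm T n.+1)^~ s)
    [set v : n.+1.-tuple T | [tuple of map f v] = w]).
    by apply: eq_fsbigr => v _; exact: calt.
  have [h hK Kh] := tuple_perm_bij s : bijective ((@tuple_perm T n.+1)^~ s).
  have [h' hK' _] := tuple_perm_bij s : bijective ((@tuple_perm T' n.+1)^~ s).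
  split=> [v /= <-|v u _ _ /(can_inj hK)//|v /= vw]; first exact: mapp.
  exists (h v); last exact: Kh.
  by apply: (can_inj hK'); rewrite -vw -mapp Kh.
Qed.

Lemma cycle_chain n (c : n.+1.-tuple T -> F^o) : c \in @cycle_pred F T K n -> chain K c.
Proof. by case: n c => [|n] c /asboolP // -[]. Qed.

(** In positive degree [d] is the boundary of a cycle, hence zero; in degree 0 it is the
    augmentation, a function on the empty tuple, which no map of vertices changes. *)
Lemma chain_map_face_cycle f g n (c : n.+1.-tuple T -> F^o) :
  c \in @cycle_pred F T K n ->
  let d := push (@tuple_behead T n) c in
  chain_map f d = chain_map g d.
Proof.
case: n c => [|n] c cK /=.
  by apply: eq_push => v _; rewrite [LHS]tuple0 [RHS]tuple0.
move: cK => /asboolP[_]; rewrite boundary_push => ->.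
by apply: eq_push => v; rewrite eqxx.
Qed.

(* The cycle [f# c - g# c] is supported on simplices [w] such that [w] and [g a]
   span a simplex of [L]: it is the boundary of its cone over [g a]. *)
Lemma chain_map_step f g a n (c : n.+1.-tuple T -> F^o) :
  contiguous f g -> (forall x, x != a -> f x = g x) -> c \in @cycle_pred F T K n ->
  chain_map f c - chain_map g c \in @boundary_pred F T' L n.
Proof.
move=> fg fga cK; have cc := cycle_chain cK; have [cfin cs _] := cc.
pose d : n.+1.-tuple T' -> F^o := chain_map f c - chain_map g c.
have ff : contiguous f f by apply: contiguous_sub fg; left.
have gg : contiguous g g by apply: contiguous_sub fg; right.
have dL : chain L d.
  rewrite /d -scaleN1r; apply: chainD; first exact: chain_map_chain.
  by apply: chainZ; exact: chain_map_chain.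
have [dfin ds dalt] := dL.
have pfin (h : T -> T') : finite_set [set v | chain_map h c v != 0].
  exact: push_finite.
apply/asboolP; exists (cone (g a) d); last first.
  apply/esym/funext => w; apply: sum_cone_cons => // u.
  rewrite sum_cons /d -scaleN1r addrC push_linear; [|exact: pfin|exact: pfin].
  rewrite !chain_map_behead// (chain_map_face_cycle f g cK) scaleN1r.
  by rewrite addNr.
split=> [|w cw|]; [exact: cone_finite| |exact: cone_alternating].
split; first by apply: cone_uniq cw => // v /ds[].
have [i wi dw] := cone_neq0 cw.
(* Tuples that avoid [a] have equal images under [f] and [g] and cancel in [d], so some tuple
   through [a] must map to this face. *)
have [v [cv av vw]] : exists v, [/\ c v != 0, a \in tval v &
    [tuple of map f v] = tuple_del w i \/ [tuple of map g v] = tuple_del w i].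
  apply: contra_neqP dw => H; apply/eqP; rewrite subr_eq0; apply/eqP.
  have [S cS] := finite_supported cfin.
  rewrite /chain_map !(pushE _ _ cS) [LHS]big_mkcond [RHS]big_mkcond.
  apply: eq_bigr => v _.
  have [->|cv] := eqVneq (c v) 0; first by rewrite !if_same.
  have [av|av] := boolP (a \in tval v).
    case: eqP => [fv|_]; first by exfalso; apply: H; exists v; split=> //; left.
    by case: eqP => [gv|//]; exfalso; apply: H; exists v; split=> //; right.
  suff -> : [tuple of map f v] = [tuple of map g v] by [].
  by apply/val_inj/eq_in_map => x xv; apply: fga; apply: contraNneq av => <-.
(* The two images of [v] together span a simplex, which contains the face and, as [a] is in [v], the
   apex [g a]. *)
have [_ /fg vL] := cs _ cv.
apply: (simplex_face vL); last exact: fset_tuple_neq0.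
rewrite -!fset_map_tuple; apply/fsubsetP => y; rewrite !inE.
move=> /tnthP[j ->]; case: (unliftP i j) => [k ->|->].
  have : tnth w (lift i k) \in tuple_del w i.
    by apply/tnthP; exists k; rewrite tnth_mktuple.
  by case: vw => <- ->; rewrite ?orbT.
by rewrite wi; apply/orP; right; exact: map_f.
Qed.

(** The differences telescope along an enumeration of a finite set of vertices containing those of
    [c]; [h s] follows [g] on [s] and [f] elsewhere. *)
Lemma contiguous_boundary f g n (c : n.+1.-tuple T -> F^o) :
  contiguous f g -> c \in @cycle_pred F T K n ->
  chain_map f c - chain_map g c \in @boundary_pred F T' L n.
Proof.
move=> fg cK; have [A cA] := chain_vertices (cycle_chain cK).
pose h (s : seq T) x := if x \in s then g x else f x.
have hE s x : h s x = f x \/ h s x = g x.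
  by rewrite /h; case: ifP; [right|left].
suff H (s : seq T) : chain_map f c - chain_map (h s) c \in @boundary_pred F T' L n.
  rewrite (_ : chain_map g c = chain_map (h A) c)//.
  by apply: eq_chain_map => v /cA vA x /vA xA; rewrite /h xA.
elim: s => [|a s IHs]; first by rewrite subrr rpred0.
rewrite -(subrK (chain_map (h s) c) (chain_map f c)) -addrA; apply: rpredD => //.
apply: (@chain_map_step _ _ a) cK; first exact: contiguous_sub fg.
by move=> x xa; rewrite /h inE (negPf xa).
Qed.

(** * Induced maps on homology *)

Section homology_map.
Variables (n : nat) (f : T -> T').
Hypothesis fK : contiguous f f.

Lemma chain_map_cycle (c : n.+1.-tuple T -> F^o) :
  c \in @cycle_pred F T K n -> chain_map f c \in @cycle_pred F T' L n.
Proof.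
case: n c => [|m] c /asboolP cK; apply/asboolP; first exact: chain_map_chain.
case: cK => cK c0; split; first exact: chain_map_chain.
rewrite boundary_chain_map; last by case: cK.
by rewrite c0; apply/funext => w; apply: fsbig1.
Qed.

Lemma chain_map_boundary (c : n.+1.-tuple T -> F^o) :
  c \in @boundary_pred F T K n -> chain_map f c \in @boundary_pred F T' L n.
Proof.
move=> /asboolP[b bK ->]; apply/asboolP; exists (chain_map f b).
  exact: chain_map_chain.
by rewrite boundary_chain_map//; case: bK.
Qed.

Definition homology_map_fun (x : homology F K n) : homology F L n :=
  subquotient_pi _ (Subspace (chain_map_cycle (subspace_valP (repr x)))).

(** Representatives of a class differ by a boundary, which is sent to a boundary, so any of them
    computes the image. *)
Lemma homology_map_pi z : homology_map_fun (subquotient_pi _ z) =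
  subquotient_pi _ (Subspace (chain_map_cycle (subspace_valP z))).
Proof.
apply/subquotient_eq => /=.
set y := repr _; have : val y - val z \in @boundary_pred F T K n.
  exact/subquotient_eq/subquotient_piK.
have yfin : finite_set [set v | val y v != 0].
  by case: (cycle_chain (subspace_valP y)).
have zfin : finite_set [set v | val z v != 0].
  by case: (cycle_chain (subspace_valP z)).
move=> /chain_map_boundary; rewrite -scaleN1r addrC /chain_map push_linear//.
by rewrite scaleN1r addrC.
Qed.

Lemma homology_map_linear : linear homology_map_fun.
Proof.
move=> a x y; rewrite -(subquotient_piK x) -(subquotient_piK y).
rewrite -subquotient_pi_linear !homology_map_pi -subquotient_pi_linear.
congr subquotient_pi; apply: val_inj => /=; apply: push_linear.
  by case: (cycle_chain (subspace_valP (repr x))).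
by case: (cycle_chain (subspace_valP (repr y))).
Qed.

HB.instance Definition _ := GRing.isLinear.Build F (homology F K n)
  (homology F L n) *:%R homology_map_fun homology_map_linear.

Definition homology_map : {linear homology F K n -> homology F L n} :=
  homology_map_fun.

End homology_map.
End simplicial.
End chain_map.

(** * Induced maps and inclusions of complexes *)

Section homology_contiguous.
Context {F : fieldType}.

Lemma homology_piP (T : choiceType) (K : simplicialComplex T) n
    (x : homology F K n) :
  exists z : Defs.subspace (@cycle_pred F T K n), x = subquotient_pi _ z.
Proof. by exists (repr x); rewrite subquotient_piK. Qed.

Lemma homology_incl_pi (T : choiceType) (K K' : simplicialComplex T) n
    (KK' : K `<=` K')
    (z : Defs.subspace (@cycle_pred F T K n)) :
  homology_incl F n KK' (subquotient_pi _ z) =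
  subquotient_pi _ (Subspace (cycle_pred_sub KK' (subspace_valP z))).
Proof. exact: (subquotient_map_pi _ (boundary_pred_sub KK')). Qed.

Context {T T' : choiceType}.
Variable n : nat.

(** Inclusions leave cycles unchanged, so the two sides are the classes of one cycle pushed by [f']
    and by [f]; contiguity replaces equality of these maps. *)
Lemma homology_map_natural (K K' : simplicialComplex T)
    (L L' : simplicialComplex T') (KK' : K `<=` K') (LL' : L `<=` L')
    (f f' : T -> T') (fs : contiguous K L f f) (fs' : contiguous K' L' f' f') x :
  contiguous K L' f' f ->
  homology_map n fs' (homology_incl F n KK' x) =
  homology_incl F n LL' (homology_map n fs x).
Proof.
move=> ff'; have [z ->] := homology_piP x; rewrite homology_incl_pi.
rewrite [LHS]homology_map_pi [homology_map _ _ _]homology_map_pi homology_incl_pi.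
apply/subquotient_eq => /=; exact: contiguous_boundary ff' (subspace_valP z).
Qed.

(** The inclusion is induced by [id], to which [g \o f] is contiguous. *)
Lemma homology_map_comp_incl (K K' : simplicialComplex T)
    (L : simplicialComplex T') (KK' : K `<=` K') (f : T -> T') (g : T' -> T)
    (fs : contiguous K L f f) (gs : contiguous L K' g g) x :
  contiguous K K' (g \o f) id ->
  homology_map n gs (homology_map n fs x) = homology_incl F n KK' x.
Proof.
move=> gf; have [z ->] := homology_piP x; rewrite homology_incl_pi.
rewrite [homology_map n fs _]homology_map_pi [LHS]homology_map_pi.
apply/subquotient_eq => /=; set c := subspace_val _.
have cK : c \in @cycle_pred F T K n := subspace_valP _.
rewrite chain_map_comp; last by case: (cycle_chain cK).
by rewrite -[X in _ - X]chain_map_id; exact: contiguous_boundary cK.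
Qed.

End homology_contiguous.

(** * Vietoris-Rips complexes and interleavings *)

Lemma diam_leP (R : realType) (X : metricType R) (A : set X) (r : R) :
  (diam A <= r%:E)%E <-> forall x y, A x -> A y -> mdist x y <= r.
Proof.
split=> [Ar x y Ax Ay|Ar].
  rewrite -lee_fin; apply: le_trans Ar; apply: ereal_sup_ubound.
  by exists x => //; exists y.
by apply: ge_ereal_sup => _ [x Ax [y Ay <-]]; rewrite lee_fin Ar.
Qed.

(** All images of a simplex under both maps are [E]-related to its vertices, so one distance bound
    handles [f], [g] and mixed pairs alike. *)
Lemma VR_contiguous (R : realType) (X Y : metricType R) (A : set X) (B : set Y)
    (r s : R) (E : X -> Y -> Prop) (f g : X -> Y) :
  (forall x y, E x y -> B y) ->
  (forall x y x' y', E x y -> E x' y' -> mdist x x' <= r -> mdist y y' <= s) ->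
  (forall x, A x -> E x (f x)) -> (forall x, A x -> E x (g x)) ->
  contiguous (VR r A) (VR s B) f g.
Proof.
move=> EB Es Ef Eg t [t0 tA /diam_leP tr].
have mem y : y \in ((f @` t) `|` (g @` t))%fset -> exists2 x, x \in t & E x y.
  by rewrite inE => /orP[] /imfsetP[x /= xt ->]; exists x => //;
    [apply: Ef|apply: Eg]; exact: tA.
split.
- have /fset0Pn[x xt] := t0.
  by apply/fset0Pn; exists (f x); rewrite inE in_imfset.
- by move=> y /mem[x _ /EB].
- apply/diam_leP => y y' /mem[x xt xy] /mem[x' xt' xy'].
  by apply: Es xy xy' _; exact: tr.
Qed.

(** * Morphisms of labeled persistent homology from a relation *)

Section labeled_interleaving.
Context {R : realType} (F : fieldType) {k l q : nat}.
Variables (X : labeledMetricSpace R k) (Y : labeledMetricSpace R l).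
Variables (rho : 'I_q -> 'I_k) (sigma : 'I_q -> 'I_l).
Variables (E : {set 'I_q} -> X -> Y -> Prop) (f : {set 'I_q} -> X -> Y).
Variables (e : {nonneg R}) (j : nat).
Hypothesis E_sub : forall (p p' : {set 'I_q}) x y,
  p \subset p' -> E p x y -> E p' x y.
Hypothesis E_cod : forall p x y, E p x y -> label_union (sigma @: p) y.
Hypothesis E_dist : forall p x y x' y',
  E p x y -> E p x' y' -> mdist y y' <= mdist x x' + e%:num.
Hypothesis E_fun : forall (p : {set 'I_q}) x,
  label_union (rho @: p) x -> E p x (f p x).

Let V := pm_stab (LPH F j X) rho.
Let W := pm_stab (LPH F j Y) sigma.

(** Since [E] grows with the labels, [f x.2] and [f y.2] both select from [E y.2]. Selections for
    distinct label sets are independent, so naturality rests on this contiguity; for [x = y] it says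
    that each selection is simplicial. *)
Lemma label_map_contiguous (x y : R *p {set 'I_q}) : (x <= y)%O ->
  contiguous (LPH_complex X (rho_tilde rho x))
    (LPH_complex Y (rho_tilde sigma (shiftP e%:num y))) (f y.2) (f x.2).
Proof.
rewrite leEprod => /andP[xy1 xy2]; apply: (@VR_contiguous _ _ _ _ _ _ _ (E y.2)).
- exact: E_cod.
- move=> u v u' v' uv uv' ur; apply: le_trans (E_dist uv uv') _.
  by rewrite /= lerD2r (le_trans ur).
- move=> u Xu; apply: E_fun; apply: bigcup_subset Xu => i /=.
  exact: fintype.subsetP (imsetS rho xy2) i.
- by move=> u Xu; apply: E_sub xy2 _; exact: E_fun.
Qed.

Definition label_map (x : R *p {set 'I_q}) :
    {linear V x -> pm_shift e%:num W x} :=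
  homology_map j (label_map_contiguous (lexx x)).

Lemma label_map_natural (x y : R *p {set 'I_q}) (xy : (x <= y)%O) v :
  label_map y (pm_map V xy v) = pm_map (pm_shift e%:num W) xy (label_map x v).
Proof. by apply: homology_map_natural; exact: label_map_contiguous. Qed.

End labeled_interleaving.

Lemma interleaved_of_relation (R : realType) (F : fieldType) (k l q : nat)
    (X : labeledMetricSpace R k) (Y : labeledMetricSpace R l)
    (rho : 'I_q -> 'I_k) (sigma : 'I_q -> 'I_l) (e : {nonneg R}) (j : nat)
    (E : {set 'I_q} -> X -> Y -> Prop) (x0 : X) (y0 : Y) :
  (forall (p p' : {set 'I_q}) x y, p \subset p' -> E p x y -> E p' x y) ->
  (forall p x y, E p x y ->
     label_union (rho @: p) x /\ label_union (sigma @: p) y) ->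
  (forall (p : {set 'I_q}) x, label_union (rho @: p) x -> exists y, E p x y) ->
  (forall (p : {set 'I_q}) y, label_union (sigma @: p) y -> exists x, E p x y) ->
  (forall p x y x' y', E p x y -> E p x' y' ->
     `|mdist x x' - mdist y y'| <= e%:num) ->
  interleaved e (pm_stab (LPH F j X) rho) (pm_stab (LPH F j Y) sigma).
Proof.
move=> E_sub E_label E_dom E_cod E_dist.
(* The default [y0] is taken only at points related to nothing, which lie outside the complexes. *)
have Ef (p : {set 'I_q}) x :
    label_union (rho @: p) x -> E p x (xget y0 [set y | E p x y]).
  by move=> /E_dom; exact: xgetPex.
have Eg (p : {set 'I_q}) y :
    label_union (sigma @: p) y -> E p (xget x0 [set x | E p x y]) y.
  by move=> /E_cod; exact: (@xgetPex _ x0 [set x | E p x y]).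
have distY (p : {set 'I_q}) x y x' y' :
    E p x y -> E p x' y' -> mdist y y' <= mdist x x' + e%:num.
  move=> xy xy'; have := E_dist _ _ _ _ _ xy xy'.
  by rewrite distrC ler_norml => /andP[_]; rewrite lerBlDl.
have distX (p : {set 'I_q}) x y x' y' :
    E p x y -> E p x' y' -> mdist x x' <= mdist y y' + e%:num.
  move=> xy xy'; have := E_dist _ _ _ _ _ xy xy'.
  by rewrite ler_norml => /andP[_]; rewrite lerBlDl.
have labX (p : {set 'I_q}) y x : E p x y -> label_union (rho @: p) x.
  by case/E_label.
have labY (p : {set 'I_q}) x y : E p x y -> label_union (sigma @: p) y.
  by case/E_label.
pose E' (p : {set 'I_q}) y x := E p x y.
pose phi := PMorphism
  (@label_map_natural _ F _ _ _ X Y rho sigma E _ e j E_sub labY distY Ef).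
pose psi := PMorphism (@label_map_natural _ F _ _ _ Y X sigma rho E' _ e j
  (fun (p p' : {set 'I_q}) y x => @E_sub p p' x y) labX
  (fun p y x y' x' => @distX p x y x' y') Eg).
exists phi, psi; split=> [x v|y w]; apply: homology_map_comp_incl.
  (* Two points are related here when they share an [E]-partner, as are a point of the union and its
     round trip image. Each passage through [E] costs [e], hence the total shift by [2 e]. *)
  apply: (@VR_contiguous _ _ _ _ _ _ _
    (fun u u' => exists2 v, E x.2 u v & E x.2 u' v)).
  - by move=> u u' [? _ /labX].
  - move=> u u' t t' [a ua u'a] [b tb t'b] ut.
    apply: le_trans (distX _ _ _ _ _ u'a t'b) _; rewrite lerD2r.
    by apply: le_trans (distY _ _ _ _ _ ua tb) _; rewrite lerD2r.
  - move=> u /Ef uf; exists (xget y0 [set y | E x.2 u y]) => //.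
    exact/Eg/labY/uf.
  - by move=> u /Ef uf; exists (xget y0 [set y | E x.2 u y]).
apply: (@VR_contiguous _ _ _ _ _ _ _
  (fun u u' => exists2 v, E y.2 v u & E y.2 v u')).
- by move=> u u' [? _ /labY].
- move=> u u' t t' [a ua u'a] [b tb t'b] ut.
  apply: le_trans (distY _ _ _ _ _ u'a t'b) _; rewrite lerD2r.
  by apply: le_trans (distX _ _ _ _ _ ua tb) _; rewrite lerD2r.
- move=> u /Eg uf; exists (xget x0 [set x | E y.2 x u]) => //.
  exact/Ef/labX/uf.
- by move=> u /Eg uf; exists (xget x0 [set x | E y.2 x u]).
Qed.

(** * Correspondences of bounded distortion *)

Lemma distortion_ge0 (R : realType) (X Y : metricType R) (C C' : set (X * Y)) :
  C !=set0 -> C' !=set0 -> (0 <= distortion C C')%E.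
Proof.
move=> [z Cz] [z' Cz'].
apply: (@le_trans _ _ `|mdist z.1 z'.1 - mdist z.2 z'.2|%:E).
  by rewrite lee_fin.
by apply: ereal_sup_ubound; exists z => //; exists z'.
Qed.

Lemma interleaved_of_distortion (R : realType) (F : fieldType) (k l q : nat)
    (X : labeledMetricSpace R k) (Y : labeledMetricSpace R l)
    (rho : 'I_q -> 'I_k) (sigma : 'I_q -> 'I_l) (e : {nonneg R}) (j : nat)
    (C : 'I_q -> set (X * Y)) (x0 : X) (y0 : Y) :
  (forall i, correspondence (lms_label X (rho i)) (lms_label Y (sigma i)) (C i)) ->
  (forall a b, (distortion (C a) (C b) <= e%:num%:E)%E) ->
  interleaved e (pm_stab (LPH F j X) rho) (pm_stab (LPH F j Y) sigma).
Proof.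
move=> corrC disC.
(* Two pairs in the union of the [C i] may come from different indices, hence the bound on
   [distortion (C a) (C b)] for all [a] and [b]. *)
pose E (p : {set 'I_q}) x y := exists2 i, i \in p & C i (x, y).
apply: (@interleaved_of_relation _ _ _ _ _ _ _ _ _ _ _ E) => //.
- by move=> p p' x y /fintype.subsetP pp' [i /pp' ip' xy]; exists i.
- move=> p x y [i ip xy]; have [CXY _ _] := corrC i; have [Xx Yy] := CXY _ xy.
  by split; [exists (rho i)|exists (sigma i)] => //=; exact: imset_f.
- move=> p x [_ /imsetP[i ip ->] Xx]; have [_ CX _] := corrC i.
  by move: Xx; rewrite -CX => -[[x' y] xy <-]; exists y; exists i.
- move=> p y [_ /imsetP[i ip ->] Yy]; have [_ _ CY] := corrC i.
  by move: Yy; rewrite -CY => -[[x y'] xy <-]; exists x; exists i.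
- move=> p x y x' y' [a _ xy] [b _ xy']; rewrite -lee_fin.
  apply: le_trans (disC a b); apply: ereal_sup_ubound.
  by exists (x, y) => //; exists (x', y').
Qed.

(** * The stability inequality *)

Local Open Scope ereal_scope.

Theorem corollary3p4p3 (R : realType) (F : fieldType) (k l : nat)
    (k_gt0 : (0 < k)%N) (l_gt0 : (0 < l)%N)
    (X : labeledMetricSpace R k) (Y : labeledMetricSpace R l) (j : nat) :
  Int_st (LPH F j X) (LPH F j Y) <= 2%:E * GH_st X Y.
Proof.
(* Moving the factor 2 to the left lets it cancel the one half in [GH], so that each tuple of
   correspondences can be treated separately. *)
rewrite -lee_pdivrMl//; apply: le_ereal_inf_tmp.
move=> _ [q [_ [_ [[rho [rhoS ->]] [sigma [sigmaS ->]] ->]]]].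
rewrite /GH lee_pmul2l//.
apply: le_ereal_inf_tmp => _ [C corrC <-].
have [x0 _] := lms_label_neq0 X (Ordinal k_gt0).
have [y0 _] := lms_label_neq0 Y (Ordinal l_gt0).
(* Surjectivity of [rho] provides an index, so the maximum [D] is not over an empty family. *)
have [i0 _ _] := rhoS (Ordinal k_gt0) I.
set D := \big[maxe/-oo]_(i < q) _.
have disD a b : distortion (C a) (C b) <= D.
  apply: le_trans (le_bigmax_cond _ _ (isT : xpredT a)).
  exact: (le_bigmax_cond _ (fun b => distortion (C a) (C b)) (isT : xpredT b)).
have D_ge0 : 0 <= D.
  have C0 : C i0 !=set0.
    have [_ CX _] := corrC i0; have := lms_label_neq0 (lms_stab X rhoS) i0.
    by rewrite -CX => -[_ [z Cz _]]; exists z.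
  exact: le_trans (distortion_ge0 C0 C0) (disD i0 i0).
(* [D = +oo] is trivial and [D_ge0] excludes [-oo]; a finite [D] is itself an interleaving
   parameter. *)
case: D disD D_ge0 => [d disD d_ge0|*|//]; last by rewrite leey.
rewrite lee_fin in d_ge0.
apply: ereal_inf_lbound; exists (NngNum d_ge0) => //.
exists q, (pm_stab (LPH F j X) rho), (pm_stab (LPH F j Y) sigma); split.
- by exists rho.
- by exists sigma.
- exact: (@interleaved_of_distortion _ _ _ _ _ X Y rho sigma (NngNum d_ge0) j C
    x0 y0 corrC disD).
Qed.
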